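(* The function $$t\mapsto I_0(t)\Big/\sqrt{\frac{\sinh 2t}{2t}}$$ is strictly decreasing from $(0,\infty)$ onto $(\sqrt{2/\pi},1)$. Consequently, the double inequality $$\sqrt{\frac{\sinh 2t}{\pi t}}<I_0(t)<\sqrt{\frac{\sinh 2t}{2t}}$$ holds for all $t>0$, or equivalently, the double inequality $$\sqrt{\frac2\pi}\sqrt{L(a,b)A(a,b)}<TQ(a,b)<\sqrt{L(a,b)A(a,b)}$$ holds for all $a,b>0$ with $a\ne b$, where the constants $\sqrt{2/\pi}$ and $1$ (multiplying $\sqrt{L(a,b)A(a,b)}$ on the left and on the right, respectively) are the best possible.
   Context: $I_0(t)=\sum_{n=0}^{\infty}\frac{t^{2n}}{2^{2n}(n!)^2}$ denotes the modified Bessel function of the first kind of order $0$. For $a,b>0$ with $a\ne b$: $TQ(a,b)=\frac2\pi\int_0^{\pi/2}a^{\cos^2\theta}b^{\sin^2\theta}\,d\theta$ is the Toader-Qi mean, $L(a,b)=\frac{b-a}{\ln b-\ln a}$ is the logarithmic mean, and $A(a,b)=\frac{a+b}{2}$ is the arithmetic mean. *)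

(* Defs.v *)
From Stdlib Require Import Arith Factorial Reals.
From Coquelicot Require Import Coquelicot.
Open Scope R_scope.

Definition bessel_I0 (t : R) : R :=
  Series (fun n : nat => t ^ (2 * n) / (2 ^ (2 * n) * (INR (fact n)) ^ 2)).

(* The powers are real powers: [Rpower x y] is exp (y * ln x), which is x^y
   for x > 0; the means are only used for positive arguments. *)
Definition toader_qi_mean (a b : R) : R :=
  2 / PI *
  RInt (fun theta : R => Rpower a (cos theta ^ 2) * Rpower b (sin theta ^ 2))
       0 (PI / 2).

Definition log_mean (a b : R) : R := (b - a) / (ln b - ln a).

Definition arith_mean (a b : R) : R := (a + b) / 2.

Definition I0_ratio (t : R) : R := bessel_I0 t / sqrt (sinh (2 * t) / (2 * t)).

(* Main.v *)
Require Import Defs.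
From Stdlib Require Import Reals Lra Lia Factorial Ranalysis5.
From Coquelicot Require Import Coquelicot.
From mathcomp Require ssreflect ssrfun ssrbool eqtype ssrnat fintype bigop binomial.
Open Scope R_scope.

(** Put [x = t ^ 2].  Both [I_0(t) ^ 2] and [sinh (2 t) / (2 t)] are power
    series in [x], with coefficients
      [(2n)! / (4 ^ n n! ^ 4)]  and  [4 ^ n / (2n + 1)!];
    the first comes from the Cauchy square of the Bessel series and the identity
    [sum_k C(n, k) ^ 2 = C(2n, n)] ([sum_sqr_C], [PS_mult_bessel]).  The quotient
    of these coefficients is the Wallis quotient
      [r_n = (2n)! (2n + 1)! / (16 ^ n n! ^ 4)],
    which starts at [1], decreases strictly, and tends to [2 / PI].

    A quotient [A(x) / B(x)] of power series whose coefficient quotients [r_n]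
    decrease is itself decreasing, and it comes arbitrarily close to the limit
    of [r_n].  Both facts follow from one estimate ([pivot_bound],
    [ratio_pivot]): the coefficients [(r_n - c) b_n] of [A - c B] change sign
    once, from plus to minus, say at the index [M]; passing from [x] to [q x]
    with [q >= 1] multiplies the positive terms by at most [q ^ M] and the
    negative ones by at least [q ^ M].  Hence a zero of [A - c B] at [x] makes it
    negative beyond [x] ([pseries_ratio_decr]), and for every [c] above the limit
    of [r_n] the function [A - c B] ends up negative
    ([pseries_ratio_eventually_below]).  With the intermediate value theorem this
    shows that [I_0(t) ^ 2 / (sinh (2 t) / (2 t))] decreases from [(0, infinity)]
    onto [(2 / PI, 1)].

    Comparing consecutive integrals of powers of the cosine on [[0, PI / 2]]
    gives the limit of [r_n] ([wallis_ratio_bounds]); the same integrals on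
    [[0, PI]], summed against the exponential series, give
      [I_0(u) = 1 / PI * int_0^PI exp (u cos x) dx]
    ([is_RInt_bessel]).  With [a = exp alpha], [b = exp beta] and
    [u = (alpha - beta) / 2], doubling the angle then turns the Toader-Qi mean
    into [sqrt (a b) I_0(u)], while [L(a, b) A(a, b)] equals
    [a b sinh (2 u) / (2 u)].  So [TQ / sqrt (L A)] takes the same values as the
    quotient of the first part, and the bounds on it and their sharpness carry
    over. *)

(** * Series with terms in the real numbers *)

(** The instance of the extensionality lemma at the reals leaves a goal that [ring]
    and [field] recognise as an equation in [R]; the same purpose is served by the other
    lemmas with the suffix [_R]. *)
Lemma is_series_ext_R (u v : nat -> R) (l : R) :
  (forall n, u n = v n) -> is_series u l -> is_series v l.
Proof. apply is_series_ext. Qed.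

Lemma sum_Sn_R (v : nat -> R) (n : nat) :
  sum_n v (S n) = sum_n v n + v (S n).
Proof. exact (sum_Sn v n). Qed.

Lemma is_RInt_ext_R (f g : R -> R) (a b l : R) :
  (forall x, f x = g x) -> is_RInt f a b l -> is_RInt g a b l.
Proof. intro H; apply is_RInt_ext; intros x _; apply H. Qed.

Lemma is_RInt_plus_R (f g : R -> R) (a b lf lg : R) :
  is_RInt f a b lf -> is_RInt g a b lg ->
  is_RInt (fun x => f x + g x) a b (lf + lg).
Proof. exact (is_RInt_plus f g a b lf lg). Qed.

Lemma is_RInt_scal_R (f : R -> R) (a b k l : R) :
  is_RInt f a b l -> is_RInt (fun x => k * f x) a b (k * l).
Proof. exact (is_RInt_scal f a b k l). Qed.

Lemma is_series_zero : is_series (fun _ => 0) 0.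
Proof.
apply filterlim_ext with (fun _ => 0); [| apply filterlim_const].
intro n; rewrite sum_n_const; symmetry; apply Rmult_0_r.
Qed.

(** Termwise comparison that keeps track of a gap at one index: this is the source of
    every strict inequality between series below. *)
Lemma is_series_le_gap (u v : nat -> R) (lu lv delta : R) (m : nat) :
  is_series u lu -> is_series v lv -> (forall n, u n <= v n) ->
  u m + delta <= v m -> lu + delta <= lv.
Proof.
intros Hu Hv Hle Hm.
pose proof (is_series_minus _ _ _ _ Hv Hu) as Hw.
set (w := fun n => v n - u n).
assert (Hpos : forall n, 0 <= sum_n w n).
{ intro n; rewrite sum_n_Reals; apply cond_pos_sum; intro k.
  unfold w; specialize (Hle k); lra. }
assert (Hpart : sum_n w m <= lv - lu).
{ apply (is_lim_seq_incr_compare (sum_n w)); [exact Hw |].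
  intro n; rewrite sum_Sn_R; unfold w at 3.
  specialize (Hle (S n)); lra. }
assert (Hterm : w m <= sum_n w m).
{ destruct m as [|m]; [rewrite sum_O; lra |].
  rewrite sum_Sn_R; specialize (Hpos m); lra. }
unfold w at 1 in Hterm; lra.
Qed.

Lemma is_pseries_pos (b : nat -> R) (x l : R) :
  (forall n, 0 < b n) -> 0 <= x -> is_pseries b x l -> 0 < l.
Proof.
intros Hb Hx Hl; apply is_pseries_R in Hl.
assert (0 + b 0%nat <= l); [| specialize (Hb 0%nat); lra].
apply (is_series_le_gap _ _ _ _ _ 0 is_series_zero Hl); simpl; [| lra].
intro n; apply Rmult_le_pos; [left; apply Hb | apply pow_le, Hx].
Qed.

Lemma CV_radius_infinite (a : nat -> R) :
  (forall n, 0 < a n) -> (forall n, a (S n) * (INR n + 1) <= a n) ->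
  CV_radius a = p_infty.
Proof.
intros Ha Hdecay; apply CV_radius_infinite_DAlembert.
- intro n; specialize (Ha n); lra.
- apply is_lim_seq_le_le with (fun _ => 0) (fun n => / INR (S n)).
  + intro n; split; [apply Rabs_pos |].
    pose proof (pos_INR n).
    rewrite Rabs_pos_eq by (left; apply Rdiv_lt_0_compat; apply Ha).
    apply Rle_div_l; [apply Ha |].
    rewrite S_INR, Rmult_comm.
    apply Rle_div_r; [lra | apply Hdecay].
  + apply is_lim_seq_const.
  + apply (is_lim_seq_incr_1 (fun n => / INR n)).
    replace (Finite 0) with (Rbar_inv p_infty) by reflexivity.
    apply is_lim_seq_inv; [apply is_lim_seq_INR | discriminate].
Qed.

Lemma is_pseries_PSeries (a : nat -> R) (x : R) :
  CV_radius a = p_infty -> is_pseries a x (PSeries a x).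
Proof.
intro Ha; apply PSeries_correct, CV_radius_inside; rewrite Ha; exact I.
Qed.

(** * Quotients of power series with decreasing coefficient quotients *)

(** Passing from [x] to [q x] multiplies the term of index [n] by [q ^ n], which is at most
    [q ^ M] for [n < M], where the terms are nonnegative, and at least [q ^ M] for the
    remaining nonpositive ones.  So the new sum is at most [q ^ M] times the old one, and the
    term of index [S M] gains one more factor [q], which makes the bound strict. *)
Lemma pivot_bound (d : nat -> R) (x q l l' : R) (M : nat) :
  0 < x -> 1 <= q ->
  (forall n, (n < M)%nat -> 0 <= d n) -> (forall n, (M <= n)%nat -> d n <= 0) ->
  is_pseries d x l -> is_pseries d (q * x) l' ->
  l' <= q ^ M * (l + d (S M) * x ^ S M * (q - 1)).
Proof.
intros Hx Hq Hpos Hneg Hl Hl'.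
apply is_pseries_R in Hl, Hl'.
assert (Hs : is_series (fun n => q ^ M * (d n * x ^ n)) (q ^ M * l))
  by exact (is_series_scal_l (q ^ M) _ _ Hl).
cut (l' + - (q ^ M * (d (S M) * x ^ S M * (q - 1))) <= q ^ M * l); [lra |].
apply (is_series_le_gap _ _ _ _ _ (S M) Hl' Hs).
- intro n; rewrite Rpow_mult_distr.
  replace (d n * (q ^ n * x ^ n)) with (q ^ n * (d n * x ^ n)) by ring.
  pose proof (pow_lt x n Hx).
  destruct (Nat.lt_ge_cases n M) as [Hn | Hn].
  + apply Rmult_le_compat_r.
    * apply Rmult_le_pos; [exact (Hpos n Hn) | lra].
    * apply Rle_pow; [exact Hq | lia].
  + rewrite (Rmult_comm (q ^ n)), (Rmult_comm (q ^ M)).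
    apply Rmult_le_compat_neg_l.
    * specialize (Hneg n Hn); nra.
    * apply Rle_pow; assumption.
- rewrite Rpow_mult_distr; simpl; right; ring.
Qed.

Lemma first_below (r : nat -> R) (c : R) :
  (exists n, r n < c) -> exists M, r M < c /\ forall n, (n < M)%nat -> c <= r n.
Proof.
intros [n Hn]; revert Hn; induction n as [n IH] using Wf_nat.lt_wf_ind; intro Hn.
destruct (Classical_Prop.classic (exists k, (k < n)%nat /\ r k < c))
  as [[k [Hk Hrk]] | Hno].
- exact (IH k Hk Hrk).
- exists n; split; trivial; intros k Hk; apply Rnot_lt_le; intro; apply Hno; eauto.
Qed.

Lemma decr_le (r : nat -> R) (m n : nat) :
  (forall k, r (S k) < r k) -> (m <= n)%nat -> r n <= r m.
Proof.
intros Hr Hmn; induction Hmn as [|n _ IH]; [lra | specialize (Hr n); lra].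
Qed.

Section RatioOfPowerSeries.

Variables a b r : nat -> R.
Hypothesis b_pos : forall n, 0 < b n.
Hypothesis r_decr : forall n, r (S n) < r n.
Hypothesis aE : forall n, a n = r n * b n.

Lemma is_pseries_shifted (c x la lb : R) :
  is_pseries a x la -> is_pseries b x lb ->
  is_pseries (fun n => (r n - c) * b n) x (la - c * lb).
Proof.
intros Ha Hb; apply is_pseries_R in Ha, Hb; apply is_pseries_R.
apply (is_series_ext_R (fun n => a n * x ^ n - c * (b n * x ^ n))).
- intro n; rewrite aE; ring.
- exact (is_series_minus _ _ _ _ Ha (is_series_scal_l c _ _ Hb)).
Qed.

(** The coefficients [(r_n - c) b_n] of [A - c B] change sign at the first index [M] with
    [r_M < c], so [pivot_bound] applies to [A - c B].  That [M] and [eps] do not depend on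
    [q] is what makes the bound negative for large [q]. *)
Lemma ratio_pivot (c x la lb : R) :
  0 < x -> (exists n, r n < c) -> is_pseries a x la -> is_pseries b x lb ->
  exists M eps, 0 < eps /\
    forall q la' lb', 1 <= q ->
      is_pseries a (q * x) la' -> is_pseries b (q * x) lb' ->
      la' - c * lb' <= q ^ M * (la - c * lb - eps * (q - 1)).
Proof.
intros Hx Hex Ha Hb.
destruct (first_below r c Hex) as [M [HM Hfirst]].
exists M, ((c - r (S M)) * b (S M) * x ^ S M); split.
- pose proof (r_decr M); pose proof (b_pos (S M)); pose proof (pow_lt x (S M) Hx).
  apply Rmult_lt_0_compat; trivial; apply Rmult_lt_0_compat; trivial; lra.
- intros q la' lb' Hq Ha' Hb'.
  eapply Rle_trans; [apply (pivot_bound (fun n => (r n - c) * b n) x q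
    (la - c * lb) _ M) | right; simpl; ring]; trivial.
  + intros n Hn; specialize (Hfirst n Hn); specialize (b_pos n); nra.
  + intros n Hn; pose proof (decr_le r M n r_decr Hn); specialize (b_pos n); nra.
  + apply is_pseries_shifted; trivial.
  + apply is_pseries_shifted; trivial.
Qed.

(** With [c = A(x) / B(x)] the function [A - c B] vanishes at [x], hence is negative
    at [y]. *)
Lemma pseries_ratio_decr (x y la lb la' lb' : R) :
  0 < x -> x < y ->
  is_pseries a x la -> is_pseries b x lb ->
  is_pseries a y la' -> is_pseries b y lb' ->
  la' / lb' < la / lb.
Proof.
intros Hx Hxy Ha Hb Ha' Hb'.
assert (Hlb : 0 < lb) by (apply (is_pseries_pos b x); trivial; lra).
assert (Hlb' : 0 < lb') by (apply (is_pseries_pos b y); trivial; lra).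
set (c := la / lb).
assert (Hc : la - c * lb = 0) by (unfold c; field; lra).
(* Otherwise all coefficients of the zero sum would be positive. *)
assert (Hex : exists n, r n < c).
{ apply Classical_Pred_Type.not_all_not_ex; intro Hno.
  pose proof (is_pseries_shifted c x la lb Ha Hb) as Hs.
  rewrite Hc in Hs; apply is_pseries_pos in Hs; [lra | | lra].
  intro n; pose proof (Hno (S n)); specialize (r_decr n); specialize (b_pos n); nra. }
set (q := y / x).
assert (Hy : y = q * x) by (unfold q; field; lra).
assert (Hq : 1 < q) by (apply Rlt_div_r; lra).
rewrite Hy in Ha', Hb'.
destruct (ratio_pivot c x la lb) as [M [eps [Heps Hle]]]; trivial.
specialize (Hle q la' lb' (Rlt_le _ _ Hq) Ha' Hb'); rewrite Hc in Hle.
apply Rlt_div_l; trivial.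
assert (0 < q ^ M) by (apply pow_lt; lra).
assert (0 < q ^ M * (eps * (q - 1)))
  by (apply Rmult_lt_0_compat; trivial; apply Rmult_lt_0_compat; lra).
lra.
Qed.

Lemma pseries_ratio_eventually_below (c : R) :
  (exists n, r n < c) ->
  (forall x, 0 < x -> ex_pseries a x) -> (forall x, 0 < x -> ex_pseries b x) ->
  exists x, 0 < x /\ PSeries a x / PSeries b x < c.
Proof.
intros Hex Ha Hb.
destruct (ratio_pivot c 1 (PSeries a 1) (PSeries b 1)) as [M [eps [Heps Hle]]];
  trivial; try (apply PSeries_correct; auto using Rlt_0_1); [lra |].
set (D := PSeries a 1 - c * PSeries b 1) in Hle.
(* For this [q] the bound [D - eps * (q - 1)] equals [D - Rabs D - 1 < 0]. *)
set (q := 1 + (Rabs D + 1) / eps).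
assert (Hq : 1 < q).
{ pose proof (Rabs_pos D).
  assert (0 < (Rabs D + 1) / eps) by (apply Rdiv_lt_0_compat; lra).
  unfold q; lra. }
exists q; split; [lra |].
specialize (Hle q (PSeries a q) (PSeries b q) (Rlt_le _ _ Hq)).
rewrite Rmult_1_r in Hle.
specialize (Hle (PSeries_correct a q (Ha q ltac:(lra)))
                (PSeries_correct b q (Hb q ltac:(lra)))).
replace (eps * (q - 1)) with (Rabs D + 1) in Hle by (unfold q; field; lra).
assert (0 < q ^ M) by (apply pow_lt; lra).
pose proof (Rle_abs D).
apply Rlt_div_l; [| nra].
apply (is_pseries_pos b q); trivial; [lra | apply PSeries_correct, Hb; lra].
Qed.

End RatioOfPowerSeries.

(** * The sum of the squares of the binomial coefficients *)

Section CentralBinomial.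

Import mathcomp.boot.ssreflect ssrfun ssrbool eqtype ssrnat fintype bigop binomial.

Lemma C_binomial (n k : nat) : (k <= n)%N -> Binomial.C n k = INR 'C(n, k).
Proof.
move=> le_kn.
have factE m : fact m = m`! by elim: m => //= m ->; rewrite factS mulSn.
rewrite /Binomial.C minusE !factE -(bin_fact le_kn) !mult_INR.
have fact_neq0 m : INR m`! <> 0 by rewrite -factE; exact: INR_fact_neq_0.
by field; split; apply: fact_neq0.
Qed.

Lemma INR_sum (F : nat -> nat) (n : nat) :
  INR (\sum_(j < n.+1) F j)%N = sum_f_R0 (fun k => INR (F k)) n.
Proof.
elim: n => [|n IHn]; first by rewrite big_ord_recl big_ord0 addn0.
by rewrite big_ord_recr /= plus_INR -IHn.
Qed.

(** Vandermonde's convolution, transferred from the natural number binomials to the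
    real-valued [Binomial.C]. *)
Lemma sum_sqr_C (n : nat) :
  sum_f_R0 (fun k => Binomial.C n k ^ 2) n =
  Binomial.C (2 * n)%coq_nat n.
Proof.
have -> : (2 * n)%coq_nat = (n + n)%N by rewrite addnn -mul2n.
rewrite C_binomial ?leq_addr // -Vandermonde.
rewrite (INR_sum (fun k => 'C(n, k) * 'C(n, n - k))%N).
apply: PartSum.sum_eq => k /leP le_kn.
by rewrite C_binomial // mult_INR bin_sub //= Rmult_1_r.
Qed.

End CentralBinomial.

(** * The coefficients of the squared Bessel function and of sinh (2 t) / (2 t) *)

(** In the variable [x = t ^ 2], as are the next two coefficient sequences. *)
Definition bessel_coef (n : nat) : R := / (4 ^ n * INR (fact n) ^ 2).

Definition bessel_sqr_coef (n : nat) : R :=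
  INR (fact (2 * n)) / (4 ^ n * INR (fact n) ^ 4).

Definition sinhc_coef (n : nat) : R := 4 ^ n / INR (fact (2 * n + 1)).

(** The quotient of [bessel_sqr_coef] by [sinhc_coef]; its limit [2 / PI] is the
    Wallis product. *)
Definition wallis_ratio (n : nat) : R :=
  INR (fact (2 * n)) * INR (fact (2 * n + 1)) / (16 ^ n * INR (fact n) ^ 4).

Lemma bessel_sqr_coefE (n : nat) :
  bessel_sqr_coef n = wallis_ratio n * sinhc_coef n.
Proof.
unfold bessel_sqr_coef, wallis_ratio, sinhc_coef.
replace (16 ^ n) with (4 ^ n * 4 ^ n)
  by (rewrite <- Rpow_mult_distr; f_equal; lra).
assert (4 ^ n <> 0) by (apply pow_nonzero; lra).
field; repeat split; auto using INR_fact_neq_0.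
Qed.

Lemma sinhc_coef_pos (n : nat) : 0 < sinhc_coef n.
Proof.
apply Rdiv_lt_0_compat; [apply pow_lt; lra | apply INR_fact_lt_0].
Qed.

Lemma bessel_coef_pos (n : nat) : 0 < bessel_coef n.
Proof.
apply Rinv_0_lt_compat, Rmult_lt_0_compat; apply pow_lt;
  [lra | apply INR_fact_lt_0].
Qed.

Lemma fact_S (n : nat) : INR (fact (S n)) = (INR n + 1) * INR (fact n).
Proof. rewrite fact_simpl, mult_INR, S_INR; reflexivity. Qed.

Lemma fact_double_add_1 (n : nat) :
  INR (fact (2 * n + 1)) = (2 * INR n + 1) * INR (fact (2 * n)).
Proof.
replace (2 * n + 1)%nat with (S (2 * n)) by lia.
rewrite fact_simpl, mult_INR, S_INR, mult_INR; simpl (INR 2); ring.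
Qed.

Lemma fact_double_S (n : nat) :
  INR (fact (2 * S n)) = (2 * INR n + 2) * INR (fact (2 * n + 1)).
Proof.
replace (2 * S n)%nat with (S (2 * n + 1)) by lia.
rewrite fact_simpl, mult_INR, S_INR, plus_INR, mult_INR;
  simpl (INR 2); simpl (INR 1); ring.
Qed.

Lemma fact_double_S_add_1 (n : nat) :
  INR (fact (2 * S n + 1)) =
  (2 * INR n + 3) * (2 * INR n + 2) * INR (fact (2 * n + 1)).
Proof.
replace (2 * S n + 1)%nat with (S (2 * S n)) by lia.
rewrite fact_simpl, mult_INR, fact_double_S, S_INR, mult_INR, (S_INR n).
simpl (INR 2); ring.
Qed.

Lemma wallis_ratio_S (n : nat) :
  wallis_ratio (S n) =
  (2 * INR n + 1) * (2 * INR n + 3) / (4 * (INR n + 1) ^ 2) * wallis_ratio n.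
Proof.
unfold wallis_ratio.
rewrite fact_double_S, fact_double_S_add_1, fact_double_add_1, fact_S;
  simpl (16 ^ S n).
pose proof (pos_INR n).
pose proof (INR_fact_neq_0 n).
assert (16 ^ n <> 0) by (apply pow_nonzero; lra).
field; repeat split; lra.
Qed.

Lemma wallis_ratio_0 : wallis_ratio 0 = 1.
Proof. unfold wallis_ratio; simpl; field. Qed.

Lemma wallis_ratio_pos (n : nat) : 0 < wallis_ratio n.
Proof.
apply Rdiv_lt_0_compat.
- apply Rmult_lt_0_compat; apply INR_fact_lt_0.
- apply Rmult_lt_0_compat; apply pow_lt; [lra | apply INR_fact_lt_0].
Qed.

(** The factor in [wallis_ratio_S] is below [1] because
    [(2n + 1) (2n + 3) = 4 (n + 1) ^ 2 - 1]. *)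
Lemma wallis_ratio_decr (n : nat) : wallis_ratio (S n) < wallis_ratio n.
Proof.
rewrite wallis_ratio_S.
pose proof (pos_INR n); pose proof (wallis_ratio_pos n).
rewrite <- (Rmult_1_l (wallis_ratio n)) at 2.
apply Rmult_lt_compat_r; trivial.
apply Rlt_div_l; nra.
Qed.

Lemma CV_radius_sinhc : CV_radius sinhc_coef = p_infty.
Proof.
apply CV_radius_infinite; [exact sinhc_coef_pos | intro n].
pose proof (pos_INR n); pose proof (INR_fact_lt_0 (2 * n + 1)).
pose proof (sinhc_coef_pos n).
replace (sinhc_coef (S n) * (INR n + 1))
  with (sinhc_coef n * (2 / (2 * INR n + 3))).
- rewrite <- (Rmult_1_r (sinhc_coef n)) at 2.
  apply Rmult_le_compat_l; [lra | apply Rle_div_l; lra].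
- unfold sinhc_coef; rewrite fact_double_S_add_1; simpl (4 ^ S n).
  field; repeat split; lra.
Qed.

Lemma CV_radius_bessel : CV_radius bessel_coef = p_infty.
Proof.
apply CV_radius_infinite; [exact bessel_coef_pos | intro n].
pose proof (pos_INR n); pose proof (INR_fact_lt_0 n).
assert (0 < 4 ^ n) by (apply pow_lt; lra).
pose proof (bessel_coef_pos n).
replace (bessel_coef (S n) * (INR n + 1))
  with (bessel_coef n * (1 / (4 * (INR n + 1)))).
- rewrite <- (Rmult_1_r (bessel_coef n)) at 2.
  apply Rmult_le_compat_l; [lra | apply Rle_div_l; lra].
- unfold bessel_coef; rewrite fact_S; simpl (4 ^ S n).
  field; repeat split; lra.
Qed.

Lemma bessel_I0_PSeries (t : R) : bessel_I0 t = PSeries bessel_coef (t ^ 2).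
Proof.
apply Series_ext; intro n; unfold bessel_coef.
rewrite !pow_mult; replace (2 ^ 2) with 4 by ring.
apply Rmult_comm.
Qed.

(** Up to the factor [1 / (4 ^ n n! ^ 2)], the terms of the Cauchy product are the squares
    [C(n, k) ^ 2]. *)
Lemma PS_mult_bessel (n : nat) :
  PS_mult bessel_coef bessel_coef n = bessel_sqr_coef n.
Proof.
unfold PS_mult.
transitivity (/ (4 ^ n * INR (fact n) ^ 2) *
              sum_f_R0 (fun k => Binomial.C n k ^ 2) n).
- rewrite scal_sum; apply sum_eq; intros k Hk; unfold bessel_coef, Binomial.C.
  replace (4 ^ n) with (4 ^ k * 4 ^ (n - k))
    by (rewrite <- pow_add; f_equal; lia).
  field; repeat split; solve [apply INR_fact_neq_0 | apply pow_nonzero; lra].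
- rewrite sum_sqr_C; unfold bessel_sqr_coef, Binomial.C.
  replace (2 * n - n)%nat with n by lia.
  field; split; solve [apply INR_fact_neq_0 | apply pow_nonzero; lra].
Qed.

Lemma is_pseries_bessel_sqr (x : R) :
  is_pseries bessel_sqr_coef x (PSeries bessel_coef x ^ 2).
Proof.
apply (is_pseries_ext _ _ _ _ PS_mult_bessel).
simpl (_ ^ 2); rewrite Rmult_1_r.
assert (Hr : Rbar_lt (Rabs x) (CV_radius bessel_coef))
  by (rewrite CV_radius_bessel; exact I).
apply is_pseries_mult; trivial; apply is_pseries_PSeries, CV_radius_bessel.
Qed.

Lemma is_pseries_sinhc (x : R) : is_pseries sinhc_coef x (PSeries sinhc_coef x).
Proof. apply is_pseries_PSeries, CV_radius_sinhc. Qed.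

Lemma sinhc_PSeries (t : R) :
  t <> 0 -> sinh (2 * t) / (2 * t) = PSeries sinhc_coef (t ^ 2).
Proof.
intro Ht.
(* The exponential series with its even part removed: [1 - (-1) ^ n] is [0] or [2]. *)
set (a := fun n => (1 - (-1) ^ n) / 2 * / INR (fact n)).
assert (Hsinh : is_pseries a (2 * t) (sinh (2 * t))).
{ apply is_pseries_R.
  pose proof (proj1 (is_pseries_R _ _ _) (is_exp_Reals (2 * t))) as Hp.
  pose proof (proj1 (is_pseries_R _ _ _) (is_exp_Reals (- (2 * t)))) as Hm.
  replace (sinh (2 * t)) with (/ 2 * (exp (2 * t) - exp (- (2 * t))))
    by (unfold sinh; field).
  apply (is_series_ext_R (fun n => / 2 * (/ INR (fact n) * (2 * t) ^ n
                                      - / INR (fact n) * (- (2 * t)) ^ n))).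
  - intro n; unfold a; replace (- (2 * t)) with (-1 * (2 * t)) by ring.
    rewrite (Rpow_mult_distr (-1)); field; apply INR_fact_neq_0.
  - exact (is_series_scal_l (/ 2) _ _ (is_series_minus _ _ _ _ Hp Hm)). }
assert (Hodd : is_pseries a (2 * t) (0 + 2 * t * PSeries sinhc_coef (t ^ 2))).
{ apply is_pseries_odd_even; apply is_pseries_R.
  - apply (is_series_ext_R (fun _ => 0)).
    + intro n; unfold a; rewrite pow_mult; replace ((-1) ^ 2) with 1 by ring.
      rewrite pow1; field; apply INR_fact_neq_0.
    + exact is_series_zero.
  - pose proof (proj1 (is_pseries_R _ _ _) (is_pseries_sinhc (t ^ 2))) as Hs.
    apply is_series_ext_R with (2 := Hs).
    intro n; unfold a, sinhc_coef.
    rewrite pow_add, pow_mult; replace ((-1) ^ 2) with 1 by ring.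
    rewrite pow1, (Rpow_mult_distr 2 t 2), (Rpow_mult_distr (2 ^ 2)).
    replace (2 ^ 2) with 4 by ring.
    field; apply INR_fact_neq_0. }
apply is_pseries_unique in Hsinh, Hodd.
rewrite <- Hsinh, Hodd; field; trivial.
Qed.

(** * Integrals of powers of the cosine and the Wallis quotient *)

(** [C(2n, n) / 4 ^ n], the mean value of [cos x ^ (2 n)]. *)
Definition central_ratio (n : nat) : R :=
  INR (fact (2 * n)) / (4 ^ n * INR (fact n) ^ 2).

Lemma central_ratio_S (n : nat) :
  central_ratio (S n) = (2 * INR n + 1) / (2 * INR n + 2) * central_ratio n.
Proof.
unfold central_ratio.
rewrite fact_double_S, fact_double_add_1, fact_S; simpl (4 ^ S n).
pose proof (pos_INR n).
field; repeat split; try apply INR_fact_neq_0; try apply pow_nonzero; lra.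
Qed.

Lemma central_ratio_pos (n : nat) : 0 < central_ratio n.
Proof.
apply Rdiv_lt_0_compat; [apply INR_fact_lt_0 |].
apply Rmult_lt_0_compat; apply pow_lt; [lra | apply INR_fact_lt_0].
Qed.

Lemma wallis_ratioE (n : nat) :
  wallis_ratio n = central_ratio n ^ 2 * (2 * INR n + 1).
Proof.
unfold wallis_ratio, central_ratio.
replace (16 ^ n) with (4 ^ n * 4 ^ n)
  by (rewrite <- Rpow_mult_distr; f_equal; lra).
rewrite fact_double_add_1.
field; split; solve [apply INR_fact_neq_0 | apply pow_nonzero; lra].
Qed.

(** Integration by parts: the derivative of [sin x * cos x ^ S n] is
    [(n + 2) cos x ^ (n + 2) - (n + 1) cos x ^ n], and the boundary terms vanish.  The
    upper bound [c] is left free because [PI / 2] is needed for the Wallis quotient and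
    [PI] for the Bessel function. *)
Lemma is_RInt_cos_pow_SS (n : nat) (c l : R) :
  sin c * cos c ^ S n = 0 ->
  is_RInt (fun x => cos x ^ n) 0 c l ->
  is_RInt (fun x => cos x ^ S (S n)) 0 c ((INR n + 1) / (INR n + 2) * l).
Proof.
intros Hc Hl; pose proof (pos_INR n).
assert (Hder : is_RInt
  (fun x => (INR n + 2) * cos x ^ S (S n) - (INR n + 1) * cos x ^ n) 0 c 0).
{ replace 0 with (minus (sin c * cos c ^ S n) (sin 0 * cos 0 ^ S n)) at 2
    by (rewrite Hc, sin_0; unfold minus, plus, opp; simpl; ring).
  apply (is_RInt_derive (fun x => sin x * cos x ^ S n)).
  - intros x _; auto_derive; trivial.
    replace (match n with 0%nat => 1 | S _ => INR n + 1 end) with (INR n + 1)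
      by (destruct n; simpl; ring).
    pose proof (sin2_cos2 x) as H2; unfold Rsqr in H2.
    assert (Hs : sin x * sin x = 1 - cos x * cos x) by lra.
    transitivity (cos x * cos x * cos x ^ n
                  - (INR n + 1) * cos x ^ n * (sin x * sin x)); [ring |].
    rewrite Hs; simpl; ring.
  - intros x _.
    apply (ex_derive_continuous (V := R_NormedModule)); auto_derive; trivial. }
pose proof (is_RInt_scal_R _ _ _ (/ (INR n + 2)) _
  (is_RInt_plus_R _ _ _ _ _ _ Hder
    (is_RInt_scal_R _ _ _ (INR n + 1) _ Hl))) as Hfin.
replace ((INR n + 1) / (INR n + 2) * l)
  with (/ (INR n + 2) * (0 + (INR n + 1) * l)) by (field; lra).
apply is_RInt_ext_R with (2 := Hfin); intro x; field; lra.
Qed.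

Lemma is_RInt_cos_pow_even (c : R) (n : nat) :
  sin c * cos c = 0 ->
  is_RInt (fun x => cos x ^ (2 * n)) 0 c (c * central_ratio n).
Proof.
intro Hc; induction n as [|n IH].
- apply is_RInt_ext with (fun _ => 1); [reflexivity |].
  replace (c * central_ratio 0) with (scal (c - 0) 1).
  + apply (is_RInt_const (V := R_NormedModule)).
  + unfold scal; simpl; unfold mult, central_ratio; simpl; field.
- replace (2 * S n)%nat with (S (S (2 * n))) by lia.
  replace (c * central_ratio (S n))
    with ((INR (2 * n) + 1) / (INR (2 * n) + 2) * (c * central_ratio n)).
  + apply is_RInt_cos_pow_SS; trivial.
    simpl (_ ^ S _); rewrite <- Rmult_assoc, Hc; ring.
  + rewrite central_ratio_S, mult_INR; simpl (INR 2).
    pose proof (pos_INR n); field; lra.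
Qed.

Lemma is_RInt_cos_pow_odd (c : R) (n : nat) :
  sin c * cos c = 0 ->
  is_RInt (fun x => cos x ^ (2 * n + 1)) 0 c
    (sin c / ((2 * INR n + 1) * central_ratio n)).
Proof.
intro Hc; induction n as [|n IH].
- apply is_RInt_ext with cos; [intros x _; simpl; ring |].
  replace (sin c / _) with (minus (sin c) (sin 0)).
  + apply (is_RInt_derive (V := R_CompleteNormedModule)).
    * intros x _; auto_derive; trivial; ring.
    * intros x _; apply (ex_derive_continuous (V := R_NormedModule)).
      auto_derive; trivial.
  + rewrite sin_0; unfold minus, plus, opp, central_ratio; simpl; field.
- replace (2 * S n + 1)%nat with (S (S (2 * n + 1))) by lia.
  replace (sin c / ((2 * INR (S n) + 1) * central_ratio (S n)))
    with ((INR (2 * n + 1) + 1) / (INR (2 * n + 1) + 2)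
          * (sin c / ((2 * INR n + 1) * central_ratio n))).
  + apply is_RInt_cos_pow_SS; trivial.
    simpl (_ ^ S _); rewrite <- Rmult_assoc, Hc; ring.
  + rewrite central_ratio_S, S_INR, plus_INR, mult_INR; simpl (INR 2); simpl (INR 1).
    pose proof (pos_INR n); pose proof (central_ratio_pos n).
    field; lra.
Qed.

Lemma is_RInt_cos_pow_decr (n : nat) (l l' : R) :
  is_RInt (fun x => cos x ^ n) 0 (PI / 2) l ->
  is_RInt (fun x => cos x ^ S n) 0 (PI / 2) l' -> l' <= l.
Proof.
pose proof PI_RGT_0 as HPI; intros Hl Hl'.
apply (is_RInt_le _ _ 0 (PI / 2) _ _ ltac:(lra) Hl' Hl).
intros x Hx.
assert (0 <= cos x) by (apply cos_ge_0; lra).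
pose proof (COS_bound x); pose proof (pow_le (cos x) n); simpl; nra.
Qed.

(** [r_n] is [2 / PI] times the quotient of the integrals of [cos x ^ (2 n)] and
    [cos x ^ (2 n + 1)] over [[0, PI / 2]].  The first bound says that this quotient is
    at least [1]; the second one compares with the integral of [cos x ^ (2 n + 2)]. *)
Lemma wallis_ratio_bounds (n : nat) :
  2 / PI <= wallis_ratio n <= 2 / PI * (1 + / (2 * INR n + 1)).
Proof.
pose proof PI_RGT_0 as HPI; pose proof (pos_INR n) as Hn.
assert (Hc : sin (PI / 2) * cos (PI / 2) = 0) by (rewrite cos_PI2; ring).
pose proof (central_ratio_pos n) as Hm.
pose proof (is_RInt_cos_pow_even (PI / 2) n Hc) as H0.
pose proof (is_RInt_cos_pow_odd (PI / 2) n Hc) as H1.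
pose proof (is_RInt_cos_pow_even (PI / 2) (S n) Hc) as H2.
replace (2 * n + 1)%nat with (S (2 * n)) in H1 by lia.
replace (2 * S n)%nat with (S (S (2 * n))) in H2 by lia.
pose proof (is_RInt_cos_pow_decr _ _ _ H0 H1) as H01.
pose proof (is_RInt_cos_pow_decr _ _ _ H1 H2) as H12.
rewrite sin_PI2 in H01, H12; rewrite central_ratio_S in H12.
(* As [r_n = (2 n + 1) m ^ 2], it remains to clear the denominators of [H01] and [H12]. *)
rewrite wallis_ratioE; set (m := central_ratio n) in *.
split.
- apply -> Rle_div_l in H01; [| apply Rmult_lt_0_compat; lra].
  apply Rle_div_l; [exact HPI |].
  replace (m ^ 2 * (2 * INR n + 1) * PI)
    with (2 * (PI / 2 * m * ((2 * INR n + 1) * m))) by field; lra.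
- apply <- Rle_div_r in H12; [| apply Rmult_lt_0_compat; lra].
  replace (2 / PI * (1 + / (2 * INR n + 1)))
    with ((2 * (2 * INR n + 2)) / (PI * (2 * INR n + 1))) by (field; lra).
  apply -> Rle_div_r; [| apply Rmult_lt_0_compat; lra].
  replace (PI / 2 * ((2 * INR n + 1) / (2 * INR n + 2) * m) * ((2 * INR n + 1) * m))
   with (m ^ 2 * (2 * INR n + 1) * (PI * (2 * INR n + 1)) / (2 * (2 * INR n + 2)))
   in H12 by (field; lra).
  apply -> Rle_div_l in H12; lra.
Qed.

Lemma wallis_ratio_gt (n : nat) : 2 / PI < wallis_ratio n.
Proof.
pose proof (wallis_ratio_decr n); pose proof (wallis_ratio_bounds (S n)); lra.
Qed.

Lemma wallis_ratio_eventually_below (c : R) :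
  2 / PI < c -> exists n, wallis_ratio n < c.
Proof.
pose proof PI_RGT_0 as HPI; intro Hc.
assert (Hgap : 0 < c * PI / 2 - 1)
  by (apply -> Rlt_div_l in Hc; lra).
destruct (archimed_cor1 _ Hgap) as [n [Hn Hn0]].
exists n; apply Rle_lt_trans with (1 := proj2 (wallis_ratio_bounds n)).
assert (0 < INR n) by (apply lt_0_INR; lia).
assert (/ (2 * INR n + 1) < c * PI / 2 - 1).
{ apply Rle_lt_trans with (2 := Hn); apply Rinv_le_contravar; lra. }
replace c with (2 / PI * (c * PI / 2)) by (field; lra).
apply Rmult_lt_compat_l; [apply Rdiv_lt_0_compat; lra | lra].
Qed.

(** * The integral representation of the Bessel function *)

(** The remainder of the exponential series at [z] is dominated by the one at [B], so
    the series converges uniformly on [|z| <= B]. *)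
Lemma exp_partial_sum_gap (z B : R) (K : nat) :
  Rabs z <= B ->
  Rabs (exp z - sum_n (fun n => z ^ n / INR (fact n)) K) <=
  exp B - sum_n (fun n => B ^ n / INR (fact n)) K.
Proof.
intro Hz.
set (S_ := fun w => sum_n (fun n => w ^ n / INR (fact n))).
assert (Hlim : forall w, is_lim_seq (fun i => S_ w (i + K)%nat) (exp w)).
{ intro w; apply -> (is_lim_seq_incr_n (S_ w) K).
  apply (is_series_ext_R (fun n => / INR (fact n) * w ^ n)).
  - intro n; unfold Rdiv; ring.
  - exact (proj1 (is_pseries_R _ _ _) (is_exp_Reals w)). }
change (Rabs (exp z - S_ z K) <= exp B - S_ B K).
assert (Hle : forall i,
  Rabs (S_ z (i + K)%nat - S_ z K) <= S_ B (i + K)%nat - S_ B K).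
{ intro i; induction i as [|i IH].
  - simpl; rewrite !Rminus_diag, Rabs_R0; lra.
  - unfold S_ in *; simpl (S i + K)%nat; rewrite !sum_Sn_R.
    set (j := S (i + K)) in *.
    assert (Rabs (z ^ j / INR (fact j)) <= B ^ j / INR (fact j)).
    { unfold Rdiv; rewrite Rabs_mult, <- RPow_abs, (Rabs_pos_eq (/ _))
        by (left; apply Rinv_0_lt_compat, INR_fact_lt_0).
      apply Rmult_le_compat_r;
        [left; apply Rinv_0_lt_compat, INR_fact_lt_0 |].
      apply pow_incr; split; [apply Rabs_pos | exact Hz]. }
    match goal with |- Rabs (?a + ?b - ?c) <= ?d + ?e - ?f =>
      replace (a + b - c) with ((a - c) + b) by ring;
      apply Rle_trans with (1 := Rabs_triang (a - c) b); lra end. }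
refine (is_lim_seq_le _ _ (Finite _) (Finite _) Hle _ _).
- apply (is_lim_seq_abs _ (Finite (exp z - S_ z K))).
  apply is_lim_seq_minus'; [apply Hlim | apply is_lim_seq_const].
- apply is_lim_seq_minus'; [apply Hlim | apply is_lim_seq_const].
Qed.

(** Only the even powers of the cosine contribute on [[0, PI]]; since [sin PI = 0] the odd
    ones integrate to [0].  An even number of terms is taken so that the partial sums of
    the exponential series match those of the Bessel series. *)
Lemma is_RInt_exp_cos_partial (u : R) (N : nat) :
  is_RInt
    (fun x => sum_n (fun n => (u * cos x) ^ n / INR (fact n)) (2 * N + 1)) 0 PI
    (sum_n (fun n => PI * (bessel_coef n * (u ^ 2) ^ n)) N).
Proof.
assert (Hc : sin PI * cos PI = 0) by (rewrite sin_PI; ring).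
assert (Heven : forall n, is_RInt
  (fun x => (u * cos x) ^ (2 * n) / INR (fact (2 * n))) 0 PI
  (PI * (bessel_coef n * (u ^ 2) ^ n))).
{ intro n.
  replace (PI * (bessel_coef n * (u ^ 2) ^ n))
    with (u ^ (2 * n) / INR (fact (2 * n)) * (PI * central_ratio n)).
  - apply is_RInt_ext_R 
      with (2 := is_RInt_scal_R _ _ _ _ _ (is_RInt_cos_pow_even PI n Hc)).
    intro x; rewrite Rpow_mult_distr; unfold Rdiv; ring.
  - unfold central_ratio, bessel_coef; rewrite pow_mult.
    field; repeat split; solve [apply INR_fact_neq_0 | apply pow_nonzero; lra]. }
assert (Hodd : forall n, is_RInt
  (fun x => (u * cos x) ^ (2 * n + 1) / INR (fact (2 * n + 1))) 0 PI 0).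
{ intro n.
  pose proof (is_RInt_cos_pow_odd PI n Hc) as H; rewrite sin_PI in H.
  replace 0 with (u ^ (2 * n + 1) / INR (fact (2 * n + 1))
                  * (0 / ((2 * INR n + 1) * central_ratio n))) at 2
    by (unfold Rdiv; ring).
  apply is_RInt_ext_R with (2 := is_RInt_scal_R _ _ _ _ _ H).
  intro x; rewrite Rpow_mult_distr; unfold Rdiv; ring. }
induction N as [|N IH].
- rewrite sum_O, <- (Rplus_0_r (PI * _)).
  apply is_RInt_ext_R
    with (2 := is_RInt_plus_R _ _ _ _ _ _ (Heven 0%nat) (Hodd 0%nat)).
  intro x; simpl (2 * 0)%nat; simpl (0 + 1)%nat; rewrite sum_Sn_R, sum_O; reflexivity.
- rewrite sum_Sn_R.
  replace (2 * S N + 1)%nat with (S (S (2 * N + 1))) by lia.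
  pose proof (is_RInt_plus_R _ _ _ _ _ _
    (is_RInt_plus_R _ _ _ _ _ _ IH (Heven (S N))) (Hodd (S N))) as H.
  replace (2 * S N + 1)%nat with (S (S (2 * N + 1))) in H by lia.
  replace (2 * S N)%nat with (S (2 * N + 1)) in H by lia.
  rewrite Rplus_0_r in H.
  apply is_RInt_ext_R with (2 := H); intro x; rewrite !sum_Sn_R; reflexivity.
Qed.

(** The partial sums of [exp (u cos x)] converge uniformly in [x], so integral and limit
    may be exchanged. *)
Lemma is_RInt_bessel (u : R) :
  is_RInt (fun x => exp (u * cos x)) 0 PI (PI * bessel_I0 u).
Proof.
destruct (filterlim_RInt
  (fun N x => sum_n (fun n => (u * cos x) ^ n / INR (fact n)) (2 * N + 1))
  0 PI eventually Hierarchy.eventually_filter (fun x => exp (u * cos x))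
  (fun N => sum_n (fun n => PI * (bessel_coef n * (u ^ 2) ^ n)) N)
  (is_RInt_exp_cos_partial u)) as [I_ [Hlim HI]].
- apply filterlim_locally; intro eps.
  assert (Hexp : is_lim_seq (fun N => sum_n (fun n => Rabs u ^ n / INR (fact n)) N)
                            (exp (Rabs u))).
  { apply (is_series_ext_R (fun n => / INR (fact n) * Rabs u ^ n)).
    - intro n; unfold Rdiv; ring.
    - exact (proj1 (is_pseries_R _ _ _) (is_exp_Reals (Rabs u))). }
  destruct (proj1 (filterlim_locally _ _) Hexp eps) as [N0 HN0].
  exists N0; intros N HN x.
  specialize (HN0 (2 * N + 1)%nat ltac:(lia)).
  assert (Hcos : Rabs (u * cos x) <= Rabs u).
  { rewrite Rabs_mult; pose proof (Rabs_pos u).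
    assert (Rabs (cos x) <= 1) by apply Rabs_le, COS_bound; nra. }
  pose proof (exp_partial_sum_gap _ _ (2 * N + 1) Hcos) as Hgap.
  apply ball_sym in HN0; apply ball_sym.
  change (Rabs (exp (Rabs u) - sum_n (fun n => Rabs u ^ n / INR (fact n)) (2 * N + 1))
          < eps) in HN0.
  change (Rabs (exp (u * cos x)
                - sum_n (fun n => (u * cos x) ^ n / INR (fact n)) (2 * N + 1)) < eps).
  apply Rle_lt_trans with (1 := Hgap), Rle_lt_trans with (2 := HN0), Rle_abs.
- replace (PI * bessel_I0 u) with I_; trivial.
  rewrite bessel_I0_PSeries.
  assert (Hs : is_series (fun n => PI * (bessel_coef n * (u ^ 2) ^ n))
                         (PI * PSeries bessel_coef (u ^ 2))).
  { apply (is_series_scal_l (V := R_NormedModule) PI), is_pseries_R.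
    apply is_pseries_PSeries, CV_radius_bessel. }
  exact (filterlim_locally_unique _ _ _ Hlim Hs).
Qed.

(** * The quotient of the Bessel function by sqrt (sinh (2 t) / (2 t)) *)

(** The square of [I0_ratio] in the variable [x = t ^ 2]. *)
Definition ratio_sqr (x : R) : R :=
  PSeries bessel_coef x ^ 2 / PSeries sinhc_coef x.

Lemma PSeries_sinhc_pos (x : R) : 0 <= x -> 0 < PSeries sinhc_coef x.
Proof.
intro Hx; exact (is_pseries_pos _ x _ sinhc_coef_pos Hx (is_pseries_sinhc x)).
Qed.

Lemma sinhc_pos (t : R) : t <> 0 -> 0 < sinh (2 * t) / (2 * t).
Proof.
intro Ht; rewrite sinhc_PSeries; trivial.
apply PSeries_sinhc_pos, pow2_ge_0.
Qed.

Lemma bessel_I0_pos (t : R) : 0 < bessel_I0 t.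
Proof.
rewrite bessel_I0_PSeries.
apply (is_pseries_pos bessel_coef (t ^ 2)); [apply bessel_coef_pos | apply pow2_ge_0 |].
apply is_pseries_PSeries, CV_radius_bessel.
Qed.

Lemma I0_ratio_sqrt (t : R) : t <> 0 -> I0_ratio t = sqrt (ratio_sqr (t ^ 2)).
Proof.
intro Ht; unfold I0_ratio, ratio_sqr.
rewrite sinhc_PSeries, <- bessel_I0_PSeries; trivial.
rewrite sqrt_div; [| apply pow2_ge_0 | apply PSeries_sinhc_pos, pow2_ge_0].
rewrite sqrt_pow2; [reflexivity | left; apply bessel_I0_pos].
Qed.

Lemma ratio_sqr_decr (x y : R) : 0 < x -> x < y -> ratio_sqr y < ratio_sqr x.
Proof.
intros Hx Hxy.
apply (pseries_ratio_decr bessel_sqr_coef sinhc_coef wallis_ratio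
  sinhc_coef_pos wallis_ratio_decr bessel_sqr_coefE x y);
  auto using is_pseries_bessel_sqr, is_pseries_sinhc.
Qed.

(** These are [2 / PI < r_n <= 1] summed against the series of [sinh (2 t) / (2 t)];
    the upper bound is strict because [r_1 < 1]. *)
Lemma ratio_sqr_bounds (x : R) : 0 < x -> 2 / PI < ratio_sqr x < 1.
Proof.
intro Hx; pose proof (PSeries_sinhc_pos x (Rlt_le _ _ Hx)) as HB.
split.
- pose proof (is_pseries_shifted _ _ _ bessel_sqr_coefE (2 / PI) x _ _
    (is_pseries_bessel_sqr x) (is_pseries_sinhc x)) as Hs.
  apply is_pseries_pos in Hs; [| | lra].
  + unfold ratio_sqr; apply -> Rlt_div_r; lra.
  + intro n; pose proof (wallis_ratio_gt n); pose proof (sinhc_coef_pos n); nra.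
- unfold ratio_sqr; apply <- Rlt_div_l; trivial; rewrite Rmult_1_l.
  assert (Hr1 : wallis_ratio 1 < 1)
    by (rewrite <- wallis_ratio_0; apply wallis_ratio_decr).
  set (delta := (1 - wallis_ratio 1) * sinhc_coef 1 * x).
  assert (0 < delta).
  { pose proof (sinhc_coef_pos 1).
    unfold delta; apply Rmult_lt_0_compat; trivial.
    apply Rmult_lt_0_compat; lra. }
  cut (PSeries bessel_coef x ^ 2 + delta <= PSeries sinhc_coef x); [lra |].
  apply (is_series_le_gap _ _ _ _ _ 1
    (proj1 (is_pseries_R _ _ _) (is_pseries_bessel_sqr x))
    (proj1 (is_pseries_R _ _ _) (is_pseries_sinhc x))).
  + intro n; rewrite bessel_sqr_coefE.
    apply Rmult_le_compat_r; [apply pow_le; lra |].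
    pose proof (decr_le wallis_ratio 0 n wallis_ratio_decr (Nat.le_0_l n)) as Hn.
    rewrite wallis_ratio_0 in Hn; pose proof (sinhc_coef_pos n); nra.
  + rewrite bessel_sqr_coefE; unfold delta; right; simpl; ring.
Qed.

Lemma ratio_sqr_0 : ratio_sqr 0 = 1.
Proof.
unfold ratio_sqr; rewrite !PSeries_0; unfold bessel_coef, sinhc_coef; simpl; field.
Qed.

Lemma continuity_pt_ratio_sqr (x : R) : 0 <= x -> continuity_pt ratio_sqr x.
Proof.
intro Hx; pose proof (PSeries_sinhc_pos x Hx).
assert (Hb : continuity_pt (PSeries bessel_coef) x)
  by (apply PSeries_continuity; rewrite CV_radius_bessel; exact I).
assert (Hs : continuity_pt (PSeries sinhc_coef) x)
  by (apply PSeries_continuity; rewrite CV_radius_sinhc; exact I).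
apply (continuity_pt_div (fun y => PSeries bessel_coef y ^ 2)); trivial; [| lra].
apply (continuity_pt_comp (PSeries bessel_coef) (fun z => z ^ 2)); trivial.
apply derivable_continuous_pt, derivable_pt_pow.
Qed.

Lemma ratio_sqr_onto (c : R) :
  2 / PI < c < 1 -> exists x, 0 < x /\ ratio_sqr x = c.
Proof.
intros [Hlo Hhi].
destruct (pseries_ratio_eventually_below bessel_sqr_coef sinhc_coef wallis_ratio
  sinhc_coef_pos wallis_ratio_decr bessel_sqr_coefE c) as [X [HX HXc]].
- exact (wallis_ratio_eventually_below c Hlo).
- intros x _; eexists; apply is_pseries_bessel_sqr.
- intros x _; eexists; apply is_pseries_sinhc.
- rewrite (is_pseries_unique _ _ _ (is_pseries_bessel_sqr X)) in HXc.
  change (ratio_sqr X < c) in HXc.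
  destruct (IVT_interv (fun x => c - ratio_sqr x) 0 X) as [x [Hx Hxc]]; trivial.
  + intros x Hx; apply continuity_pt_minus.
    * apply continuity_pt_const; intros ? ?; reflexivity.
    * apply continuity_pt_ratio_sqr; lra.
  + rewrite ratio_sqr_0; lra.
  + lra.
  + exists x; split; [| lra].
    destruct (proj1 Hx) as [Hpos | Hzero]; trivial.
    rewrite <- Hzero, ratio_sqr_0 in Hxc; lra.
Qed.

Lemma two_div_PI_pos : 0 < 2 / PI.
Proof. apply Rdiv_lt_0_compat; [lra | apply PI_RGT_0]. Qed.

Lemma I0_ratio_bounds (t : R) : t <> 0 -> sqrt (2 / PI) < I0_ratio t < 1.
Proof.
intro Ht; rewrite I0_ratio_sqrt; trivial.
destruct (ratio_sqr_bounds (t ^ 2)) as [Hlo Hhi]; [exact (pow2_gt_0 t Ht) |].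
pose proof two_div_PI_pos.
split; [| rewrite <- sqrt_1]; apply sqrt_lt_1; lra.
Qed.

Lemma I0_ratio_onto (y : R) :
  sqrt (2 / PI) < y < 1 -> exists t, 0 < t /\ I0_ratio t = y.
Proof.
intros [Hlo Hhi].
pose proof two_div_PI_pos as Hpi.
pose proof (sqrt_pos (2 / PI)); pose proof (sqrt_sqrt (2 / PI) (Rlt_le _ _ Hpi)).
destruct (ratio_sqr_onto (y ^ 2)) as [x [Hx Hxy]]; [split; nra |].
pose proof (sqrt_lt_R0 x Hx).
exists (sqrt x); split; trivial.
rewrite I0_ratio_sqrt, pow2_sqrt, Hxy by lra.
apply sqrt_pow2; lra.
Qed.

Lemma bessel_I0E (t : R) :
  t <> 0 -> bessel_I0 t = I0_ratio t * sqrt (sinh (2 * t) / (2 * t)).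
Proof.
intro Ht; unfold I0_ratio; field.
apply Rgt_not_eq, sqrt_lt_R0, sinhc_pos, Ht.
Qed.

(** * The Toader-Qi mean *)

(** Since [cos x ^ 2 alpha + sin x ^ 2 beta = (alpha + beta) / 2 + u cos (2 x)] with
    [u = (alpha - beta) / 2], the substitution [y = 2 x] reduces the mean to
    [is_RInt_bessel]. *)
Lemma toader_qi_meanE (alpha beta : R) :
  toader_qi_mean (exp alpha) (exp beta) =
  exp ((alpha + beta) / 2) * bessel_I0 ((alpha - beta) / 2).
Proof.
set (u := (alpha - beta) / 2); set (g := exp ((alpha + beta) / 2)).
pose proof PI_RGT_0 as HPI.
assert (Hu : is_RInt (fun x => exp (u * cos x)) (2 * 0 + 0) (2 * (PI / 2) + 0)
                     (PI * bessel_I0 u)).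
{ replace (2 * 0 + 0) with 0 by ring; replace (2 * (PI / 2) + 0) with PI by field.
  apply is_RInt_bessel. }
pose proof (is_RInt_scal_R _ _ _ (g / 2) _ (is_RInt_comp_lin _ 2 0 0 (PI / 2) _ Hu)) as H.
unfold toader_qi_mean; rewrite (is_RInt_unique _ _ _ (g / 2 * (PI * bessel_I0 u))).
- field; lra.
- apply is_RInt_ext_R with (2 := H); intro x.
  unfold Rpower; rewrite !ln_exp, <- exp_plus.
  change (g / 2 * (2 * exp (u * cos (2 * x + 0))) =
          exp (cos x ^ 2 * alpha + sin x ^ 2 * beta)).
  replace (g / 2 * (2 * exp (u * cos (2 * x + 0))))
    with (g * exp (u * cos (2 * x + 0))) by field.
  unfold g; rewrite <- exp_plus; f_equal; unfold u.
  rewrite Rplus_0_r, cos_2a.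
  pose proof (sin2_cos2 x) as H2; unfold Rsqr in H2.
  replace (alpha + beta) with ((alpha + beta) * (sin x * sin x + cos x * cos x))
    by (rewrite H2; ring).
  field.
Qed.

Lemma log_arith_meanE (alpha beta : R) :
  alpha <> beta ->
  log_mean (exp alpha) (exp beta) * arith_mean (exp alpha) (exp beta) =
  exp ((alpha + beta) / 2) ^ 2 *
  (sinh (2 * ((alpha - beta) / 2)) / (2 * ((alpha - beta) / 2))).
Proof.
intro Hne; unfold log_mean, arith_mean, sinh; rewrite !ln_exp.
replace (2 * ((alpha - beta) / 2)) with (alpha - beta) by field.
replace (exp ((alpha + beta) / 2) ^ 2) with (exp alpha * exp beta)
  by (simpl; rewrite Rmult_1_r, <- !exp_plus; f_equal; field).
replace (exp (- (alpha - beta))) with (exp beta * / exp alpha)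
  by (rewrite <- exp_Ropp, <- exp_plus; f_equal; ring).
replace (exp (alpha - beta)) with (exp alpha * / exp beta)
  by (rewrite <- exp_Ropp, <- exp_plus; reflexivity).
pose proof (exp_pos alpha); pose proof (exp_pos beta).
field; repeat split; lra.
Qed.

Lemma sqrt_log_arith_mean (alpha beta : R) :
  alpha <> beta ->
  let S := sqrt (log_mean (exp alpha) (exp beta) * arith_mean (exp alpha) (exp beta)) in
  0 < S /\ toader_qi_mean (exp alpha) (exp beta) = I0_ratio ((alpha - beta) / 2) * S.
Proof.
intro Hne; cbv zeta.
set (u := (alpha - beta) / 2).
assert (Hu : u <> 0) by (unfold u; lra).
rewrite log_arith_meanE, toader_qi_meanE, bessel_I0E; trivial; fold u.
pose proof (exp_pos ((alpha + beta) / 2)) as Hg.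
pose proof (sinhc_pos u Hu) as Hs.
rewrite sqrt_mult, sqrt_pow2; try lra; [| apply pow2_ge_0].
split; [| ring].
apply Rmult_lt_0_compat; [exact Hg | apply sqrt_lt_R0, Hs].
Qed.

Lemma toader_qi_ratio (a b : R) :
  0 < a -> 0 < b -> a <> b ->
  exists u, u <> 0 /\ 0 < sqrt (log_mean a b * arith_mean a b) /\
    toader_qi_mean a b = I0_ratio u * sqrt (log_mean a b * arith_mean a b).
Proof.
intros Ha Hb Hab.
rewrite <- (exp_ln a Ha), <- (exp_ln b Hb).
assert (Hne : ln a <> ln b) by (intro H; apply Hab, ln_inv; trivial).
exists ((ln a - ln b) / 2); split; [lra | exact (sqrt_log_arith_mean _ _ Hne)].
Qed.

(** The choice [a = exp t], [b = exp (- t)] realises every value of [I0_ratio] as a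
    quotient [TQ / sqrt (L A)]. *)
Lemma toader_qi_attains (y : R) :
  sqrt (2 / PI) < y < 1 ->
  exists a b, 0 < a /\ 0 < b /\ a <> b /\
    0 < sqrt (log_mean a b * arith_mean a b) /\
    toader_qi_mean a b = y * sqrt (log_mean a b * arith_mean a b).
Proof.
intro Hy; destruct (I0_ratio_onto y Hy) as [t [Ht <-]].
exists (exp t), (exp (- t)).
destruct (sqrt_log_arith_mean t (- t)) as [Hpos Heq]; [lra |].
replace ((t - - t) / 2) with t in Heq by field.
repeat split; auto using exp_pos.
intro H; apply exp_inv in H; lra.
Qed.

Theorem mainTheorem8 :
  (forall s t : R, 0 < s -> s < t -> I0_ratio t < I0_ratio s)
  /\ (forall y : R,
        (exists t : R, 0 < t /\ I0_ratio t = y) <-> sqrt (2 / PI) < y < 1)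
  /\ (forall t : R, 0 < t ->
        sqrt (sinh (2 * t) / (PI * t)) < bessel_I0 t
        /\ bessel_I0 t < sqrt (sinh (2 * t) / (2 * t)))
  /\ (forall a b : R, 0 < a -> 0 < b -> a <> b ->
        sqrt (2 / PI) * sqrt (log_mean a b * arith_mean a b)
          < toader_qi_mean a b
        /\ toader_qi_mean a b < sqrt (log_mean a b * arith_mean a b))
  /\ (forall c : R,
        (forall a b : R, 0 < a -> 0 < b -> a <> b ->
           c * sqrt (log_mean a b * arith_mean a b) <= toader_qi_mean a b) ->
        c <= sqrt (2 / PI))
  /\ (forall c : R,
        (forall a b : R, 0 < a -> 0 < b -> a <> b ->
           toader_qi_mean a b <= c * sqrt (log_mean a b * arith_mean a b)) ->
        1 <= c).
Proof.
pose proof two_div_PI_pos as Hpi.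
assert (Hlt1 : sqrt (2 / PI) < 1) by (destruct (I0_ratio_bounds 1); lra).
split; [| split; [| split; [| split; [| split]]]].
- intros s t Hs Hst; rewrite !I0_ratio_sqrt by lra.
  destruct (ratio_sqr_bounds (t ^ 2)) as [Hlo _]; [nra |].
  apply sqrt_lt_1_alt; split; [lra | apply ratio_sqr_decr; nra].
- intro y; split; [| apply I0_ratio_onto].
  intros [t [Ht <-]]; apply I0_ratio_bounds; lra.
- intros t Ht.
  assert (Hs : 0 < sinh (2 * t) / (2 * t)) by (apply sinhc_pos; lra).
  replace (sinh (2 * t) / (PI * t)) with (2 / PI * (sinh (2 * t) / (2 * t)))
    by (pose proof PI_RGT_0; field; lra).
  rewrite sqrt_mult by lra; rewrite (bessel_I0E t) by lra.
  apply sqrt_lt_R0 in Hs.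
  destruct (I0_ratio_bounds t) as [Hlo Hhi]; [lra |].
  split; nra.
- intros a b Ha Hb Hab.
  destruct (toader_qi_ratio a b Ha Hb Hab) as [u [Hu [HS ->]]].
  destruct (I0_ratio_bounds u Hu) as [Hlo Hhi].
  split; nra.
- intros c Hc; apply Rnot_lt_le; intro Hlt.
  (* A value of the quotient strictly between [sqrt (2 / PI)] and [c]. *)
  set (y := (sqrt (2 / PI) + Rmin c 1) / 2).
  assert (Hmin : sqrt (2 / PI) < Rmin c 1) by (apply Rmin_glb_lt; trivial).
  pose proof (Rmin_l c 1); pose proof (Rmin_r c 1).
  destruct (toader_qi_attains y) as [a [b [Ha [Hb [Hab [HS HT]]]]]];
    [unfold y; lra |].
  specialize (Hc a b Ha Hb Hab); rewrite HT in Hc.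
  apply Rmult_le_reg_r in Hc; [unfold y in Hc; lra | exact HS].
- intros c Hc; apply Rnot_lt_le; intro Hlt.
  (* A value of the quotient strictly between [c] and [1]. *)
  set (y := (1 + Rmax c (sqrt (2 / PI))) / 2).
  assert (Hmax : Rmax c (sqrt (2 / PI)) < 1) by (apply Rmax_lub_lt; trivial).
  pose proof (Rmax_l c (sqrt (2 / PI))); pose proof (Rmax_r c (sqrt (2 / PI))).
  destruct (toader_qi_attains y) as [a [b [Ha [Hb [Hab [HS HT]]]]]];
    [unfold y; lra |].
  specialize (Hc a b Ha Hb Hab); rewrite HT in Hc.
  apply Rmult_le_reg_r in Hc; [unfold y in Hc; lra | exact HS].
Qed.
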